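(* Let $\alpha>0$ and, for $x,y>0$, let $$K(x,y)=(x\wedge y)\Big(\frac{x\wedge y}{x\vee y}-\frac12\Big)_+\log^\alpha(e+x\wedge y).$$ (i) If $\alpha>2$, then any weak solution $(f_t)_{t\ge0}$ to the Smoluchowski coagulation equation with kernel $K$ such that $M_1(f_0)\in(0,\infty)$ is gelling. (ii) If $\alpha\in(0,2]$, then any weak solution $(f_t)_{t\ge0}$ to the Smoluchowski coagulation equation with kernel $K$ starting from $f_0=\delta_1$ (the Dirac mass at $1$) is non-gelling.
   Context: Notation: $x\wedge y=\min\{x,y\}$, $x\vee y=\max\{x,y\}$, $u_+=\max\{u,0\}$, $\log^\alpha(z)=(\log z)^\alpha$. For a nonnegative measure $f$ on $(0,\infty)$ and $k\in\mathbb{R}$, $M_k(f)=\int_0^\infty x^k f(\mathrm{d}x)$. Weak solution: let $K:(0,\infty)^2\to[0,\infty)$ be measurable and symmetric ($K(x,y)=K(y,x)$). A measurable family $(f_t)_{t\ge0}$ of nonnegative measures on $(0,\infty)$ is a weak solution to the Smoluchowski coagulation equation with kernel $K$ if for all $t\ge0$, $$\int_0^t\int_0^\infty\int_0^\infty K(x,y)\,f_s(\mathrm{d}y)f_s(\mathrm{d}x)\,\mathrm{d}s<\infty,$$ and for all bounded measurable $\psi:(0,\infty)\to[0,\infty)$ and all $t\ge0$, $$\int_0^\infty\psi(x)f_t(\mathrm{d}x)=\int_0^\infty\psi(x)f_0(\mathrm{d}x)+\frac12\int_0^t\int_0^\infty\int_0^\infty\Delta_\psi(x,y)K(x,y)\,f_s(\mathrm{d}y)f_s(\mathrm{d}x)\,\mathrm{d}s,$$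 where $\Delta_\psi(x,y)=\psi(x+y)-\psi(x)-\psi(y)$. The first two terms of this identity take values in $[0,\infty)\cup\{+\infty\}$, and the last one is finite. Gelling: a weak solution $(f_t)_{t\ge0}$ with $M_1(f_0)<\infty$ is gelling if it loses mass in finite time, i.e. $T_{gel}:=\inf\{t\ge0: M_1(f_t)<M_1(f_0)\}<\infty$ (with $\inf\emptyset=+\infty$); it is non-gelling if $M_1(f_t)=M_1(f_0)$ for all $t\ge0$. *)

(* Defs.v *)
From HB Require Import structures.
From mathcomp Require Import all_boot all_order all_algebra.
From mathcomp Require Import all_classical all_reals all_analysis.
From mathcomp Require Import measurable_realfun.

Set Implicit Arguments.
Unset Strict Implicit.
Unset Printing Implicit Defensive.

Import Order.TTheory GRing.Theory Num.Theory.
Import numFieldNormedType.Exports.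

Local Open Scope classical_set_scope.
Local Open Scope ring_scope.

(* A measure on (0, +oo) is encoded as a Borel measure on R that does not
   charge ]-oo, 0]. *)
Notation borel_measure R := (measure (measurableTypeR R) R).

Definition moment (R : realType) (k : R) (mu : borel_measure R) : \bar R :=
  (\int[mu]_(x in `]0%R, +oo[) (x `^ k)%:E)%E.

(* Time ranges over [0, +oo[; the values f t for t < 0 are irrelevant. *)
Definition measurable_family (R : realType) (f : R -> borel_measure R) : Prop :=
  (forall t : R, 0 <= t -> f t `]-oo, 0]%classic = 0%E) /\
  (forall A : set (measurableTypeR R), measurable A ->
     measurable_fun (`[0, +oo[ : set R) (fun t => f t A)).

Definition Delta (R : realType) (psi : R -> R) (x y : R) : R :=
  psi (x + y) - psi x - psi y.

Definition weak_solution (R : realType) (K : R -> R -> R)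
    (f : R -> borel_measure R) : Prop :=
  [/\ measurable_family f,
      forall t : R, 0 <= t ->
        (\int[lebesgue_measure]_(s in `[0%R, t])
           \int[f s]_(x in `]0%R, +oo[) \int[f s]_(y in `]0%R, +oo[)
             (K x y)%:E < +oo)%E
    & forall psi : R -> R,
        measurable_fun (`]0, +oo[ : set R) psi ->
        (exists c : R, forall x : R, 0 < x -> 0 <= psi x <= c) ->
        forall t : R, 0 <= t ->
          (\int[f t]_(x in `]0%R, +oo[) (psi x)%:E =
           \int[f 0%R]_(x in `]0%R, +oo[) (psi x)%:E +
           (2^-1)%:E *
           \int[lebesgue_measure]_(s in `[0%R, t])
             \int[f s]_(x in `]0%R, +oo[) \int[f s]_(y in `]0%R, +oo[)
               (Delta psi x y * K x y)%:E)%E].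

Definition T_gel (R : realType) (f : R -> borel_measure R) : \bar R :=
  ereal_inf [set t%:E | t in
    [set t : R | 0 <= t /\ (moment 1 (f t) < moment 1 (f 0%R))%E]].

Definition gelling (R : realType) (f : R -> borel_measure R) : Prop :=
  (T_gel f < +oo)%E.

Definition non_gelling (R : realType) (f : R -> borel_measure R) : Prop :=
  forall t : R, 0 <= t -> moment 1 (f t) = moment 1 (f 0).

Definition Kalpha (R : realType) (alpha x y : R) : R :=
  Num.min x y * Num.max (Num.min x y / Num.max x y - 2^-1) 0
  * ln (expR 1 + Num.min x y) `^ alpha.

(* Main.v *)
Require Import Defs.
From HB Require Import structures.
From mathcomp Require Import all_boot all_order all_algebra.
From mathcomp Require Import all_classical all_reals all_analysis.
From mathcomp Require Import measurable_realfun.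
From mathcomp Require Import ring lra.
Import Order.TTheory GRing.Theory Num.Theory.
Import numFieldNormedType.Exports.
Local Open Scope classical_set_scope.
Local Open Scope ring_scope.

(** Every test function psi used below satisfies Delta psi * K <= 0, so the weak
equation becomes an energy balance
  int psi f_t + (dissipation up to time t) = int psi f_0     (lemma [dissipation])
in which all three terms are nonnegative: the dissipation is bounded by the
initial datum.

Gelation for alpha > 2.  Take psi(x) = min(x, A).  Two particles of size at
least A that merge make psi lose A, and on the block [A, 3A/2[ the ratio of the
sizes is at least 2/3, so that K is at least a multiple of A log^alpha(e + A).
With v_A(s) = A f_s([A, 3A/2[) this yields
  int_0^T v_A(s)^2 ds <= 12 M_1(f_0) / log^alpha(e + A)      ([block_estimate]).
Along A_n = eps (3/2)^n the right-hand side decays like n^-alpha, so by Young's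
inequality the time integral of sum_n v_(A_n), which controls the mass above
eps, is at most C sqrt T sum_n n^(-alpha/2), and the series converges because
alpha/2 > 1.  Hence the mass above eps is small at some time before T, for
T large.  Since the mass below eps can only decrease (test function
x 1_(x <= eps)), total mass has been lost as soon as eps is chosen with some
initial mass above it ([gelling_of_log_power]).

No gelation for alpha <= 2 from a Dirac mass at 1.  The kernel vanishes when one
size is at least twice the other, so powers of two react only with an equal
partner, and f_t stays concentrated on them ([support_pow2]).  Writing a_n for
the mass of the atom 2^n and l_n = log^(alpha/2)(e + 2^n), the equation is a
cascade of shells
  a_0 + ... + a_N + F_N = 1,   F_N(t) = int_0^t (l_N a_N)^2 / 2,
where F_N is the mass that has left the first N + 1 shells ([atom_mass_cascade]).
Subtracting two such balances gives a_(n+1)' = ((l_n a_n)^2 - (l_(n+1)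
a_(n+1))^2) / 2, and since l_n increases a maximum principle propagates the
bound l_n a_n <= l_0 ([shell_max_principle]).  Then F_N <= F_n <= (l_0 l_n / 2)
int_0^t a_n for n <= N, and summing over n with sum_n a_n <= 1,
  F_N sum_(n <= N) 1 / l_n <= l_0 t / 2                      ([flux_decay]).
For alpha <= 2 the sum diverges like the harmonic series, so F_N tends to 0 and
no mass escapes to infinity ([moment1_dirac_start]). *)

(** * Integrals of nonnegative functions without measurability *)

Section off_null_set.
Context d (T : measurableType d) (R : realType) (mu : {measure set T -> \bar R}).
Import HBNNSimple.

(** The inner integrals of the weak equation are functions of x and s whose
measurability would require a Fubini-type argument for the family f_s.
Comparison avoids it: a nonnegative integral is a supremum over simple functions
below the integrand, and multiplying such a simple function by the indicator of
the complement of a null set does not change its integral. *)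
Lemma ge0_le_integral_off_null (D N : set T) (f g : T -> \bar R) :
  measurable N -> mu N = 0%E ->
  (forall x, D x -> (0 <= f x)%E) -> (forall x, D x -> (0 <= g x)%E) ->
  (forall x, D x -> ~ N x -> (f x <= g x)%E) ->
  (\int[mu]_(x in D) f x <= \int[mu]_(x in D) g x)%E.
Proof.
move=> mN N0 f0 g0 fg.
rewrite [leLHS]ge0_integralE// [leRHS]ge0_integralE//.
apply: ge_ereal_sup => _ [h /= hf <-].
have mNC : measurable (~` N) by exact: measurableC.
have -> : sintegral mu h = sintegral mu (proj_nnsfun h mNC).
  rewrite -!integralT_nnsfun.
  apply: ge0_ae_eq_integral => //.
  - exact/measurable_EFinP.
  - exact/measurable_EFinP.
  - by move=> x _; rewrite lee_fin.
  - by move=> x _; rewrite lee_fin.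
  - exists N; split => // x /=.
    apply: contra_notP => Nx _.
    by rewrite /= mindicE mem_set ?mulr1.
apply: ereal_sup_ubound => /=; exists (proj_nnsfun h mNC) => // x.
have := hf x; rewrite /= mindicE /patch; case: ifPn => xD hx.
- have [xN|xN] := boolP (x \in ~` N).
    rewrite mulr1 (le_trans hx)//; apply: fg; first exact: set_mem.
    exact: set_mem xN.
  by rewrite mulr0 g0//; exact: set_mem.
- by case: (x \in ~` N); rewrite ?mulr1 ?mulr0.
Qed.

Lemma ge0_le_integral_nonmeasurable (D : set T) (f g : T -> \bar R) :
  (forall x, D x -> (0 <= f x)%E) -> (forall x, D x -> (f x <= g x)%E) ->
  (\int[mu]_(x in D) f x <= \int[mu]_(x in D) g x)%E.
Proof.
move=> f0 fg; apply: (@ge0_le_integral_off_null _ set0) => // x Dx; last by move=> _; exact: fg.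
exact: le_trans (f0 _ Dx) (fg _ Dx).
Qed.

Lemma ge0_eq_integral_off_null (D N : set T) (f g : T -> \bar R) :
  measurable N -> mu N = 0%E ->
  (forall x, D x -> (0 <= f x)%E) -> (forall x, D x -> (0 <= g x)%E) ->
  (forall x, D x -> ~ N x -> f x = g x) ->
  (\int[mu]_(x in D) f x = \int[mu]_(x in D) g x)%E.
Proof.
move=> mN N0 f0 g0 fg; apply/eqP; rewrite eq_le; apply/andP; split;
  by apply: (@ge0_le_integral_off_null D N) => // x Dx Nx; rewrite fg.
Qed.

End off_null_set.

(** * The weak equation as an energy balance *)

(** The sign condition makes the triple integral the opposite of a nonnegative
one.  That integral is finite, for otherwise the right-hand side of the weak
equation would be -oo while the left-hand side is nonnegative; hence it can be
moved to the other side. *)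
Lemma dissipation (R : realType) (K : R -> R -> R) (f : R -> borel_measure R)
    (psi : R -> R) :
  weak_solution K f ->
  measurable_fun (`]0, +oo[ : set R) psi ->
  (exists c : R, forall x : R, 0 < x -> 0 <= psi x <= c) ->
  (forall x y, 0 < x -> 0 < y -> Delta psi x y * K x y <= 0) ->
  forall t : R, 0 <= t ->
  (\int[f t]_(x in `]0%R, +oo[) (psi x)%:E +
   (2^-1)%:E *
   \int[lebesgue_measure]_(s in `[0%R, t])
     \int[f s]_(x in `]0%R, +oo[) \int[f s]_(y in `]0%R, +oo[)
       (- (Delta psi x y * K x y))%:E = \int[f 0%R]_(x in `]0%R, +oo[) (psi x)%:E)%E.
Proof.
move=> [_ _ weakf] mpsi bpsi dpsi t t0; move: (bpsi) => [c psi_c].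
have := weakf psi mpsi bpsi t t0.
have pos (x : R) : `]0, +oo[%classic x -> 0 < x by rewrite /= in_itv/= andbT.
set X := (\int[lebesgue_measure]_(s in `[0%R, t]) _)%E => ->.
set Y := (\int[lebesgue_measure]_(s in `[0%R, t]) _)%E.
have ge2 s x : `]0, +oo[%classic x -> (0 <= \int[f s]_(y in `]0%R, +oo[)
    (- (Delta psi x y * K x y))%:E)%E.
  move=> /pos x0; apply: integral_ge0 => y /pos y0.
  by rewrite lee_fin oppr_ge0 dpsi.
have ge1 s : (0 <= \int[f s]_(x in `]0%R, +oo[) \int[f s]_(y in `]0%R, +oo[)
    (- (Delta psi x y * K x y))%:E)%E.
  by apply: integral_ge0 => x; exact: ge2.
have XY : (X = - Y)%E.
  rewrite /Y -integral_ge0N//; apply: eq_integral => s _.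
  rewrite -integral_ge0N//; last by move=> x; exact: ge2.
  apply: eq_integral => x /set_mem /pos x0.
  rewrite -integral_ge0N//; last first.
    by move=> y /pos y0; rewrite lee_fin oppr_ge0 dpsi.
  by apply: eq_integral => y _; rewrite EFinN oppeK.
have Y0 : (0 <= Y)%E by apply: integral_ge0.
have := weakf psi mpsi bpsi t t0; rewrite -/X XY.
have := Y0; rewrite le_eqVlt => /orP[/eqP <-|].
  by rewrite oppe0 mule0 !adde0.
case: Y Y0 {XY} => [y y0 yp _|_ _|//].
  rewrite -EFinN -!EFinM -addeA -EFinD.
  by rewrite mulrN addNr adde0.
have : (0 <= \int[f t]_(x in `]0%R, +oo[) (psi x)%:E)%E.
  by apply: integral_ge0 => x /pos x0; rewrite lee_fin; case/andP: (psi_c x x0).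
move=> + E; rewrite E.
by rewrite /= gt0_muleNy ?lte_fin ?invr_gt0// addeNy.
Qed.

Lemma dissipation_le (R : realType) (K : R -> R -> R) (f : R -> borel_measure R)
    (psi : R -> R) :
  weak_solution K f ->
  measurable_fun (`]0, +oo[ : set R) psi ->
  (exists c : R, forall x : R, 0 < x -> 0 <= psi x <= c) ->
  (forall x y, 0 < x -> 0 < y -> Delta psi x y * K x y <= 0) ->
  forall t : R, 0 <= t ->
  (\int[f t]_(x in `]0%R, +oo[) (psi x)%:E <= \int[f 0%R]_(x in `]0%R, +oo[) (psi x)%:E)%E.
Proof.
move=> wf mpsi bpsi dpsi t t0.
rewrite -(@dissipation _ _ _ _ wf mpsi bpsi dpsi _ t0) leeDl//.
rewrite mule_ge0//.
apply: integral_ge0 => s _; apply: integral_ge0 => x; rewrite /= in_itv/= andbT => x0.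
apply: integral_ge0 => y; rewrite /= in_itv/= andbT => y0.
by rewrite lee_fin oppr_ge0 dpsi.
Qed.
(** * The kernel on a block and the truncated moment *)

Lemma Kalpha_ge0 (R : realType) (alpha x y : R) : 0 < x -> 0 < y ->
  0 <= Kalpha alpha x y.
Proof.
move=> x0 y0; rewrite /Kalpha !mulr_ge0 ?powR_ge0//.
  by rewrite le_min !ltW.
by rewrite le_max lexx orbT.
Qed.

Lemma ln_expR1D_ge1 (R : realType) (x : R) : 0 <= x -> 1 <= ln (expR 1 + x).
Proof.
move=> x0; rewrite -[leLHS](expRK 1) ler_ln ?posrE ?expR_gt0// ?lerDl//.
by rewrite ltr_pwDl ?expR_gt0.
Qed.

(** The block [A, 3A/2[ is chosen with ratio 3/2 < 2, so that the factor
min/max - 1/2 is at least 2/3 - 1/2 = 1/6 on it. *)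
Lemma Kalpha_block (R : realType) (alpha A x y : R) : 0 <= alpha -> 0 < A ->
  A <= x < 3 / 2 * A -> A <= y < 3 / 2 * A ->
  A / 6 * ln (expR 1 + A) `^ alpha <= Kalpha alpha x y.
Proof.
move=> a0 A0 /andP[Ax xA] /andP[Ay yA].
have x0 : 0 < x by exact: lt_le_trans Ax.
have y0 : 0 < y by exact: lt_le_trans Ay.
have Am : A <= Num.min x y by rewrite le_min Ax.
rewrite /Kalpha ler_pM//.
- by rewrite divr_ge0// ltW.
- exact: powR_ge0.
- apply: ler_pM => //; first exact: ltW.
  rewrite le_max; apply/orP; left.
  have M0 : 0 < Num.max x y by rewrite lt_max x0.
  rewrite lerBrDr ler_pdivlMr//.
  have -> : 6^-1 + 2^-1 = 2 / 3 :> R by lra.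
  by case: (leP x y) => _; lra.
- apply: ge0_ler_powR => //; rewrite ?nnegrE.
  + exact: le_trans (ln_expR1D_ge1 _ _ (ltW A0)).
  + exact: le_trans (ln_expR1D_ge1 _ _ (le_trans (ltW A0) Am)).
  + by rewrite ler_ln ?posrE ?lerD2l// addr_gt0 ?expR_gt0// (lt_le_trans A0).
Qed.

Lemma Delta_min_le0 (R : realType) (A x y : R) : 0 < A -> 0 < x -> 0 < y ->
  Delta (fun z => Num.min z A) x y <= 0.
Proof.
move=> A0 x0 y0; rewrite /Delta.
by case: (leP (x + y) A); case: (leP x A); case: (leP y A); lra.
Qed.

Lemma moment1E (R : realType) (mu : borel_measure R) :
  moment 1 mu = (\int[mu]_(x in `]0%R, +oo[) x%:E)%E.
Proof.
rewrite /moment; apply: eq_integral => x.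
by rewrite inE/= in_itv/= andbT => x0; rewrite powRr1// ltW.
Qed.

(** The cap A makes the test function bounded while keeping it below x, which
bounds both the solution and its dissipation by the initial mass. *)
Lemma truncated_le_moment1 (R : realType) (K : R -> R -> R) (f : R -> borel_measure R)
    (A t : R) :
  weak_solution K f -> (forall x y, 0 < x -> 0 < y -> 0 <= K x y) ->
  0 < A -> 0 <= t ->
  (\int[f t]_(x in `]0%R, +oo[) (Num.min x A)%:E +
   (2^-1)%:E *
   \int[lebesgue_measure]_(s in `[0%R, t])
     \int[f s]_(x in `]0%R, +oo[) \int[f s]_(y in `]0%R, +oo[)
       (- (Delta (fun z => Num.min z A) x y * K x y))%:E <= moment 1 (f 0%R))%E.
Proof.
move=> wf K0 A0 t0.
rewrite (dissipation _ _ _ _ wf _ _ _ _ t0).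
- rewrite moment1E; apply: ge0_le_integral_nonmeasurable => x.
  + by rewrite /= in_itv/= andbT lee_fin => x0; rewrite le_min !ltW.
  + by rewrite lee_fin ge_min lexx.
- by apply: (@measurable_minr _ _ R _ (fun z : R => z) (cst A)).
- by exists A => x x0; rewrite ge_min le_min lexx orbT andbT !ltW.
- move=> x y x0 y0; rewrite mulr_le0_ge0//; last exact: K0.
  exact: Delta_min_le0.
Qed.

(** The number of particles may be infinite near 0 but not away from 0, by
Markov's inequality for the truncated moment. *)
Lemma tail_fin_num (R : realType) (K : R -> R -> R) (f : R -> borel_measure R)
    (A t : R) :
  weak_solution K f -> (forall x y, 0 < x -> 0 < y -> 0 <= K x y) ->
  (moment 1 (f 0%R) < +oo)%E ->
  0 < A -> 0 <= t -> f t `[A, +oo[%classic \is a fin_num.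
Proof.
move=> wf K0 m0 A0 t0.
rewrite ge0_fin_numE//.
have := truncated_le_moment1 _ _ _ _ _ wf K0 A0 t0.
set X := (\int[lebesgue_measure]_(s in _) _)%E => H.
have X0 : (0 <= X)%E.
  apply: integral_ge0 => s _; apply: integral_ge0 => x; rewrite /= in_itv/= andbT => x0.
  apply: integral_ge0 => y; rewrite /= in_itv/= andbT => y0.
  rewrite lee_fin oppr_ge0 mulr_le0_ge0//; last exact: K0.
  exact: Delta_min_le0.
have : (A%:E * f t `[A, +oo[%classic < +oo)%E.
  apply: le_lt_trans m0; apply: le_trans H.
  apply: le_trans (leeDl _ _); last by rewrite mule_ge0.
  rewrite -(setIidl (_ : `[A, +oo[ `<=` `]0, +oo[%classic)); last first.
    by move=> x /=; rewrite !in_itv/= !andbT; exact: lt_le_trans.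
  rewrite -integral_indic; [|exact: measurable_itv|exact: measurable_itv].
  rewrite -ge0_integralZl_EFin//; last 2 first.
  - by apply/measurable_EFinP; apply: measurable_indic; exact: measurable_itv.
  - exact: ltW.
  apply: ge0_le_integral_nonmeasurable => x; first by rewrite -EFinM lee_fin mulr_ge0// ltW.
  rewrite /= in_itv/= andbT -EFinM lee_fin indicE => x0.
  have [|_] := boolP (x \in `[A, +oo[%classic); last by rewrite mulr0 le_min !ltW.
  by rewrite inE/= in_itv/= andbT => Ax; rewrite mulr1 le_min Ax lexx.
have := measure_ge0 (f t) `[A, +oo[%classic.
move: (f t _) => [r| |] // _; first by rewrite !ltry.
by rewrite gt0_muley// lte_fin.
Qed.
(** * The mass of a block *)

(** The weight A stands for the size x; it is within a factor 3/2 of x on the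
block. *)
Definition block_mass (R : realType) (f : R -> borel_measure R) (A s : R) : R :=
  A * fine (f s `[A, 3 / 2 * A[%classic).

Arguments block_mass {R} f A s.

Lemma block_fin_num (R : realType) (K : R -> R -> R) (f : R -> borel_measure R)
    (A B t : R) :
  weak_solution K f -> (forall x y, 0 < x -> 0 < y -> 0 <= K x y) ->
  (moment 1 (f 0%R) < +oo)%E ->
  0 < A -> 0 <= t -> f t `[A, B[%classic \is a fin_num.
Proof.
move=> wf K0 m0 A0 t0.
have := tail_fin_num _ _ _ _ _ wf K0 m0 A0 t0.
rewrite !ge0_fin_numE//; apply: le_lt_trans.
apply: le_measure; rewrite ?inE; [exact: measurable_itv|exact: measurable_itv|].
by move=> x /=; rewrite !in_itv/= andbT => /andP[].
Qed.

Lemma measurable_block_mass (R : realType) (f : R -> borel_measure R) (A t : R) :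
  measurable_family f ->
  measurable_fun (`[0, t]%classic : set R) (block_mass f A).
Proof.
move=> [_ mf].
apply: measurable_funM => //.
apply: (@measurableT_comp _ _ _ _ _ _ fine _
  (fun s => f s `[A, 3 / 2 * A[%classic)).
  exact: fine_measurable.
apply: measurable_funS (mf _ (measurable_itv _)) => //.
by move=> x /=; rewrite !in_itv/= andbT => /andP[].
Qed.

(** The constant 12 collects the 1/2 of the weak equation and the 1/6 of
[Kalpha_block]; one factor A comes from the kernel and one from the amount that
min(x, A) loses in a merger, so that A^2 f_s(I)^2 is the square of the block
mass. *)
Lemma block_estimate (R : realType) (alpha : R) (f : R -> borel_measure R) (A t : R) :
  0 <= alpha -> weak_solution (Kalpha alpha) f ->
  (moment 1 (f 0%R) < +oo)%E -> 0 < A -> 0 <= t ->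
  ((ln (expR 1 + A) `^ alpha / 12)%:E *
    \int[lebesgue_measure]_(s in `[0%R, t]) (block_mass f A s ^+ 2)%:E
     <= moment 1 (f 0%R))%E.
Proof.
move=> a0 wf m0 A0 t0.
have K0 := Kalpha_ge0 R alpha.
apply: le_trans (truncated_le_moment1 _ _ _ _ _ wf K0 A0 t0).
have pos (x : R) : `]0, +oo[%classic x -> 0 < x by rewrite /= in_itv/= andbT.
apply: le_trans (leeDr _ _); last first.
  by apply: integral_ge0 => x /pos x0; rewrite lee_fin le_min !ltW.
set L := ln _ `^ _.
have L0 : 0 <= L by exact: powR_ge0.
have -> : ((L / 12)%:E = (2^-1)%:E * (L / 6)%:E :> \bar R)%E.
  by rewrite -EFinM; congr EFin; lra.
rewrite -muleA lee_pmul2l ?lte_fin ?invr_gt0//.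
rewrite -ge0_integralZl_EFin//; last 3 first.
- by move=> s _; rewrite lee_fin sqr_ge0.
- apply/measurable_EFinP; apply: measurable_funX.
  by case: wf => + _ _; exact: measurable_block_mass.
- by rewrite divr_ge0.
apply: ge0_le_integral_nonmeasurable => s; first by rewrite mule_ge0 ?lee_fin ?sqr_ge0 ?divr_ge0.
rewrite /= in_itv/= => /andP[s0 _].
pose I : set (measurableTypeR R) := `[A, 3 / 2 * A[%classic.
have mI : measurable I by exact: measurable_itv.
have Ifin : f s I \is a fin_num by exact: block_fin_num wf K0 m0 A0 s0.
have subI : I `<=` `]0, +oo[%classic.
  by move=> x /=; rewrite !in_itv/= andbT => /andP[Ax _]; exact: lt_le_trans A0 Ax.
have mID : measurable_fun (`]0, +oo[%classic : set (measurableTypeR R)) (\1_I : _ -> R).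
  exact: measurable_indic.
have intI : (\int[f s]_(x in `]0%R, +oo[) (\1_I x)%:E = f s I)%E.
  by rewrite integral_indic// setIidl.
have I0 x : 0 <= \1_I x :> R by rewrite indicE ler0n.
pose c := A ^+ 2 * (L / 6).
have c0 : 0 <= c by rewrite mulr_ge0 ?sqr_ge0 ?divr_ge0.
have -> : ((L / 6)%:E * (block_mass f A s ^+ 2)%:E =
    \int[f s]_(x in `]0%R, +oo[) \int[f s]_(y in `]0%R, +oo[)
      (c * \1_I x * \1_I y)%:E)%E.
  transitivity (\int[f s]_(x in `]0%R, +oo[) ((c * fine (f s I))%:E * (\1_I x)%:E))%E.
    rewrite ge0_integralZl_EFin//; last 2 first.
    - exact/measurable_EFinP.
    - by rewrite mulr_ge0// fine_ge0.
    rewrite intI -{2}(fineK Ifin) -!EFinM; congr EFin.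
    by rewrite /block_mass /c exprMn; ring.
  apply: eq_integral => x _.
  under eq_integral do rewrite EFinM.
  rewrite ge0_integralZl_EFin//; last 2 first.
  - exact/measurable_EFinP.
  - by rewrite mulr_ge0.
  by rewrite intI -{2}(fineK Ifin) -!EFinM; congr EFin; ring.
apply: ge0_le_integral_nonmeasurable => x.
  by move=> _; apply: integral_ge0 => y _; rewrite lee_fin; apply: mulr_ge0 => //; exact: mulr_ge0.
move=> /pos x0; apply: ge0_le_integral_nonmeasurable => y.
  by move=> _; rewrite lee_fin; apply: mulr_ge0 => //; exact: mulr_ge0.
move=> /pos y0; rewrite lee_fin -mulNr !indicE.
have D0 := Delta_min_le0 _ A x y A0 x0 y0.
have [xI|xI] := boolP (x \in I); last first.
  by rewrite mulr0 mul0r mulr_ge0 ?K0 ?oppr_ge0.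
have [yI|yI] := boolP (y \in I); last first.
  by rewrite mulr0 mulr_ge0 ?K0 ?oppr_ge0.
rewrite !mulr1 /c expr2 -mulrA.
move: xI yI; rewrite !inE /I /= !in_itv/= => xI yI.
apply: ler_pM => //; [exact: ltW|by rewrite mulr_ge0 ?divr_ge0// ltW| |].
- move: xI yI => /andP[Ax _] /andP[Ay _]; rewrite /Delta.
  by case: (leP (x + y) A); case: (leP x A); case: (leP y A); lra.
- apply: le_trans (Kalpha_block _ _ _ _ _ a0 A0 xI yI).
  by rewrite -/L; lra.
Qed.
(** * Summability over geometric blocks *)

(** Cauchy condensation: the dyadic group of indices between 2^J and 2^(J+1)
contributes at most 2^J 2^(-pJ) = q^J with q = 2^(1-p) < 1. *)
Lemma sum_powR_inv_bounded (R : realType) (p : R) : 1 < p ->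
  exists Z : R, forall N, \sum_(0 <= n < N) (n.+1%:R `^ p)^-1 <= Z.
Proof.
move=> p1; pose q : R := 2 `^ (1 - p).
have q0 : 0 < q by exact: powR_gt0.
have q1 : q < 1.
  rewrite /q -opprB powRN invf_lt1 ?powR_gt0//.
  have {1}-> : 1 = 1 `^ (p - 1) :> R by rewrite powR1.
  by rewrite gt0_ltr_powR ?nnegrE ?subr_gt0// ltr1n.
have dyadic J : \sum_(1 <= n < 2 ^ J) (n%:R `^ p)^-1 <= series (geometric 1 q) J.
  elim: J => [|J IH]; first by rewrite expn0 big_geq// /series/= big_geq.
  have J0 : (0 < 2 ^ J)%N by rewrite expn_gt0.
  rewrite (big_cat_nat J0) /=; last by rewrite leq_exp2l.
  rewrite seriesSr lerD//.
  apply: (@le_trans _ _ (\sum_(2 ^ J <= i < 2 ^ J.+1) ((2 ^ J)%:R `^ p)^-1)).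
    apply: ler_sum_nat => i /andP[Ji _].
    rewrite lef_pV2 ?posrE ?powR_gt0 ?ltr0n ?(leq_trans J0)//.
    by rewrite ge0_ler_powR ?nnegrE ?ler0n ?ler_nat// (le_trans ler01)// ltW.
  rewrite sumr_const_nat expnS mul2n -addnn addnK /geometric /= mul1r.
  rewrite -[leLHS]mulr_natl -powRN -{1}(powRr1 (ler0n _ (2 ^ J))) -powRD; last first.
    by apply/implyP => _; rewrite pnatr_eq0 -lt0n.
  by rewrite natrX -!powR_mulrn ?powR_ge0// -!powRrM mulrC.
exists (1 / (1 - q)) => N.
rewrite -(big_add1 _ _ 0 N.+1 xpredT (fun n => (n%:R `^ p)^-1)).
apply: le_trans (le_trans (dyadic N) _); last first.
  by apply: geometric_le_lim; rewrite // ger0_norm// ltW.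
rewrite (@big_cat_nat _ _ _ N.+1 1 (2 ^ N))//=; last exact: ltn_expl.
by rewrite lerDl sumr_ge0// => i _; rewrite invr_ge0 powR_ge0.
Qed.

(** The logarithm grows linearly in n, with slope log(3/2), but only once
A (3/2)^n exceeds 1; the additive e keeps it above 1 before that.  A convex
combination of the bounds ln >= 1 and ln >= ln A + n log(3/2), with weights
proportional to q + l and 1, gives a lower bound valid for all n. *)
Lemma ln_expR1D_geometric (R : realType) (A : R) : 0 < A ->
  exists2 c : R, 0 < c &
    forall n, c * n.+1%:R <= ln (expR 1 + A * (3 / 2) ^+ n).
Proof.
move=> A0; pose l : R := ln (3 / 2).
have l0 : 0 < l by rewrite ln_gt0//; lra.
pose q : R := Num.max 0 (- ln A).
have q0 : 0 <= q by rewrite /q le_max lexx.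
have D0 : 0 < 1 + q + l by rewrite addr_gt0// ltr_pwDl.
exists (l / (1 + q + l)) => [|n]; first by rewrite divr_gt0.
have r0 : 0 < (3 / 2 : R) by lra.
have An0 : 0 < A * (3 / 2) ^+ n by rewrite mulr_gt0// exprn_gt0.
set M := ln _.
have M1 : 1 <= M by apply: ln_expR1D_ge1; exact: ltW.
have Ml : ln A + n%:R * l <= M.
  apply: (@le_trans _ _ (ln (A * (3 / 2) ^+ n))).
    by rewrite lnM ?posrE ?exprn_gt0// lnXn// mulr_natl.
  by rewrite ler_ln ?posrE ?addr_gt0 ?expR_gt0// lerDr expR_ge0.
have Aq : - ln A <= q by rewrite /q le_max lexx orbT.
rewrite mulrAC ler_pdivrMr// -natr1.
have : (q + l) * 1 <= (q + l) * M by rewrite ler_wpM2l// addr_ge0// ltW.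
lra.
Qed.

Lemma sum_ln_powR_inv_bounded (R : realType) (alpha A : R) : 2 < alpha -> 0 < A ->
  exists Z : R, forall N,
    \sum_(0 <= n < N) (ln (expR 1 + A * (3 / 2) ^+ n) `^ (alpha / 2))^-1 <= Z.
Proof.
move=> a2 A0; have [c c0 cP] := ln_expR1D_geometric R A A0.
have p1 : 1 < alpha / 2 by lra.
have [Z ZP] := sum_powR_inv_bounded R (alpha / 2) p1.
exists ((c `^ (alpha / 2))^-1 * Z) => N.
apply: le_trans (ler_wpM2l _ (ZP N)); last by rewrite invr_ge0 powR_ge0.
rewrite mulr_sumr; apply: ler_sum_nat => n _.
rewrite -invfM -powRM ?ler0n ?(ltW c0)//.
have cn0 : 0 < c * n.+1%:R by rewrite mulr_gt0 ?ltr0n.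
rewrite lef_pV2 ?posrE ?powR_gt0//; last exact: lt_le_trans (cP n).
rewrite ge0_ler_powR ?nnegrE//; first by lra.
- exact: ltW.
- by apply: le_trans (cP n); exact: ltW.
Qed.

Lemma geometric_block_exists (R : realType) (A x : R) : 0 < A -> A <= x ->
  exists n : nat, A * (3 / 2) ^+ n <= x < 3 / 2 * (A * (3 / 2) ^+ n).
Proof.
move=> A0 Ax.
have bern n : n%:R / 2 <= (3 / 2 : R) ^+ n.
  elim: n => [|n IH]; first by rewrite mul0r expr0.
  have g1 : 1 <= (3 / 2 : R) ^+ n by apply: exprn_ege1; lra.
  by rewrite -natr1 exprS; lra.
have ex : exists n, x < A * (3 / 2) ^+ n.+1.
  (* (3/2)^n >= n/2, so n + 1 > 2 x / A is enough *)
  exists (Num.trunc (2 * x / A)).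
  rewrite -ltr_pdivrMl//; apply: lt_le_trans (bern _).
  have := truncnS_gt (2 * x / A).
  by rewrite -mulrA (mulrC x) => lt_trunc; lra.
case: (ex_minnP ex) => n xn nmin; exists n.
rewrite exprS mulrCA in xn; rewrite xn andbT.
case: n nmin {xn} => [|n] nmin; first by rewrite expr0 mulr1.
by rewrite leNgt; apply/negP => /nmin; rewrite ltnn.
Qed.
(** * Splitting the mass at a threshold *)

Definition cutoff (R : realType) (B x : R) : R := x * \1_(`]-oo, B]) x.
Arguments cutoff {R} B x.

Lemma cutoffE (R : realType) (B x : R) : cutoff B x = if x <= B then x else 0.
Proof.
rewrite /cutoff indicE.
have -> : (x \in `]-oo, B]%classic) = (x <= B).
  by apply/idP/idP; rewrite inE/= in_itv.
by case: ifP; rewrite ?mulr1 ?mulr0.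
Qed.

Lemma measurable_cutoff (R : realType) (D : set R) (B : R) :
  measurable_fun D (cutoff B : R -> R).
Proof. by apply: measurable_funM => //; exact: measurable_indic. Qed.

Lemma cutoff_ge0 (R : realType) (B x : R) : 0 < x -> 0 <= cutoff B x.
Proof. by move=> x0; rewrite cutoffE; case: ifP => // _; exact: ltW. Qed.

Lemma cutoff_le (R : realType) (B x : R) : 0 < x -> cutoff B x <= x.
Proof. by move=> x0; rewrite cutoffE; case: ifP => // _; exact: ltW. Qed.

Lemma cutoff_bounded (R : realType) (B : R) :
  exists c : R, forall x : R, 0 < x -> 0 <= cutoff B x <= c.
Proof.
exists (Num.max B 0) => x x0; rewrite cutoff_ge0//= cutoffE le_max.
by case: ifP => [->//|_]; rewrite lexx orbT.
Qed.

(** A merger either keeps the mass below the threshold or removes it. *)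
Lemma Delta_cutoff_le0 (R : realType) (B x y : R) : 0 < x -> 0 < y ->
  Delta (cutoff B) x y <= 0.
Proof.
move=> x0 y0; rewrite /Delta !cutoffE.
by case: (leP (x + y) B); case: (leP x B); case: (leP y B); lra.
Qed.

Lemma le_integral_nneseries d (T : measurableType d) (R : realType)
    (mu : {measure set T -> \bar R}) (D : set T) (f : T -> \bar R)
    (g : nat -> T -> \bar R) :
  measurable D -> (forall n, measurable_fun D (g n)) ->
  (forall x, D x -> (0 <= f x)%E) -> (forall n x, D x -> (0 <= g n x)%E) ->
  (forall x, D x -> (f x <= \sum_(n <oo) g n x)%E) ->
  (\int[mu]_(x in D) f x <= \sum_(n <oo) \int[mu]_(x in D) g n x)%E.
Proof.
move=> mD mg f0 g0 fg; rewrite -integral_nneseries//.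
exact: ge0_le_integral_nonmeasurable.
Qed.

Lemma nneseries_term_le (R : realType) (u : nat -> \bar R) (n : nat) :
  (forall k, (0 <= u k)%E) -> (u n <= \sum_(k <oo) u k)%E.
Proof.
move=> u0; apply: le_trans (nneseries_lim_ge n.+1 _); last by move=> *; exact: u0.
by rewrite big_nat_recr//= leeDr// sume_ge0.
Qed.

(** Otherwise x would be dominated by the countable sum over n of the functions
x 1_(x > 1/(n+1)), all of integral 0. *)
Lemma exists_tail_gt0 (R : realType) (mu : borel_measure R) :
  (0 < moment 1 mu)%E ->
  exists2 e : R, 0 < e & (0 < \int[mu]_(x in `]0%R, +oo[) (x - cutoff e x)%:E)%E.
Proof.
move=> m0; apply: contrapT => H.
have {}H n : (\int[mu]_(x in `]0%R, +oo[) (x - cutoff n.+1%:R^-1 x)%:E = 0)%E.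
  apply/eqP; rewrite eq_le integral_ge0 ?andbT; last first.
    move=> x; rewrite /= in_itv/= andbT => x0.
    by rewrite lee_fin subr_ge0 cutoff_le.
  rewrite leNgt; apply/negP => h; apply: H; exists n.+1%:R^-1 => //.
suff : (moment 1 mu <= 0)%E by rewrite leNgt m0.
rewrite moment1E.
have -> : (0 = \sum_(n <oo)
    \int[mu]_(x in `]0%R, +oo[) (x - cutoff n.+1%:R^-1 x)%:E :> \bar R)%E.
  by rewrite eseries0.
apply: le_integral_nneseries.
- exact: measurable_itv.
- move=> n; apply/measurable_EFinP; apply: measurable_funB => //.
  exact: measurable_cutoff.
- by move=> x; rewrite /= in_itv/= andbT lee_fin => /ltW.
- move=> n x; rewrite /= in_itv/= andbT => x0.
  by rewrite lee_fin subr_ge0 cutoff_le.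
- move=> x; rewrite /= in_itv/= andbT => x0.
  pose n := Num.trunc x^-1.
  have nx : n.+1%:R^-1 < x.
    rewrite -[ltRHS]invrK ltf_pV2 ?posrE ?invr_gt0//.
    exact: truncnS_gt.
  apply: le_trans (nneseries_term_le _ _ n _).
    by rewrite lee_fin cutoffE (lt_geF nx) subr0.
  by move=> k; rewrite lee_fin subr_ge0 cutoff_le.
Qed.

Lemma moment1_split (R : realType) (mu : borel_measure R) (e : R) :
  (moment 1 mu = \int[mu]_(x in `]0%R, +oo[) (cutoff e x)%:E +
    \int[mu]_(x in `]0%R, +oo[) (x - cutoff e x)%:E)%E.
Proof.
have pos (x : R) : `]0, +oo[%classic x -> 0 < x by rewrite /= in_itv/= andbT.
rewrite moment1E -ge0_integralD//.
- by apply: eq_integral => x _; rewrite -EFinD addrC subrK.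
- by move=> x /pos x0; rewrite lee_fin cutoff_ge0.
- apply/measurable_EFinP; exact: measurable_cutoff.
- by move=> x /pos x0; rewrite lee_fin subr_ge0 cutoff_le.
- apply/measurable_EFinP; apply: measurable_funB => //.
  exact: measurable_cutoff.
Qed.

(** The blocks starting at e (3/2)^n cover ]e, +oo[, and x < (3/2) A on the block
that starts at A. *)
Lemma tail_le_blocks (R : realType) (K : R -> R -> R) (f : R -> borel_measure R)
    (e s : R) :
  weak_solution K f -> (forall x y, 0 < x -> 0 < y -> 0 <= K x y) ->
  (moment 1 (f 0%R) < +oo)%E -> 0 < e -> 0 <= s ->
  (\int[f s]_(x in `]0%R, +oo[) (x - cutoff e x)%:E <=
   \sum_(n <oo) (3 / 2 * block_mass f (e * (3 / 2) ^+ n) s)%:E)%E.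
Proof.
move=> wf K0 m0 e0 s0.
pose A n : R := e * (3 / 2) ^+ n.
have A0 n : 0 < A n by rewrite mulr_gt0// exprn_gt0//; lra.
pose I n : set (measurableTypeR R) := `[A n, 3 / 2 * A n[%classic.
have mI n : measurable (I n) by exact: measurable_itv.
have c0 n : 0 <= 3 / 2 * A n by rewrite mulr_ge0 ?ltW//; lra.
have g0 n x : (0 <= ((3 / 2 * A n) * \1_(I n) x)%:E)%E.
  by rewrite lee_fin mulr_ge0// indicE ler0n.
have term n : (\int[f s]_(x in `]0%R, +oo[) ((3 / 2 * A n) * \1_(I n) x)%:E =
    (3 / 2 * block_mass f (A n) s)%:E)%E.
  under eq_integral do rewrite EFinM.
  rewrite ge0_integralZl_EFin//; last first.
    by apply/measurable_EFinP; exact: measurable_indic.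
  rewrite integral_indic// setIidl; last first.
    by move=> x /=; rewrite !in_itv/= andbT => /andP[Ax _]; exact: lt_le_trans (A0 n) Ax.
  rewrite /block_mass (mulrA _ (A n)) [RHS]EFinM fineK//.
  exact: (block_fin_num _ _ _ _ _ _ wf K0 m0 (A0 n) s0).
under eq_eseriesr do rewrite -term.
apply: le_integral_nneseries => //.
- by move=> n; apply/measurable_EFinP; apply: measurable_funM => //; exact: measurable_indic.
- move=> x; rewrite /= in_itv/= andbT => x0.
  by rewrite lee_fin subr_ge0 cutoff_le.
- move=> x; rewrite /= in_itv/= andbT => x0.
  rewrite cutoffE; case: (leP x e) => [_|ex].
    by rewrite subrr; apply: nneseries_ge0 => n _ _; exact: g0.
  have [n /andP[nx xn]] := geometric_block_exists _ _ _ e0 (ltW ex).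
  apply: le_trans (nneseries_term_le _ _ n _) => //.
  rewrite lee_fin subr0 indicE mem_set ?mulr1; first exact: ltW.
  by rewrite /I /= in_itv/= nx.
Qed.
(** * Gelation for exponents larger than 2 *)

Lemma le_moment1_of_not_gelling (R : realType) (f : R -> borel_measure R) (s : R) :
  ~ gelling f -> 0 <= s -> (moment 1 (f 0%R) <= moment 1 (f s))%E.
Proof.
move=> ng s0; rewrite leNgt; apply/negP => lt_m; apply: ng.
apply: le_lt_trans (ltry s); apply: ereal_inf_lbound.
by exists s.
Qed.

(** Young's inequality 2 v <= k l v^2 + 1/(k l) is applied with a weight
proportional to l_n = ln^(alpha/2), the square root of the gain in
[block_estimate], so that both terms integrate to a multiple of 1/l_n over a
time interval of length k^2.  If no mass were lost, the mass above the
threshold e would stay at least delta > 0, hence delta k^2 <= C Z k with Z a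
bound on the sums of the 1/l_n, which fails for k large. *)
Lemma gelling_of_log_power (R : realType) (alpha : R) (f : R -> borel_measure R) :
  2 < alpha -> weak_solution (Kalpha alpha) f ->
  (0 < moment 1 (f 0%R) < +oo)%E -> gelling f.
Proof.
move=> a2 wf /andP[m0 moo]; apply: contrapT => ng.
have a0 : 0 <= alpha by lra.
have K0 := Kalpha_ge0 R alpha.
have pos (x : R) : `]0, +oo[%classic x -> 0 < x by rewrite /= in_itv/= andbT.
have mf : measurable_family f by case: wf.
have [e e0 tail0] := exists_tail_gt0 _ _ m0.
pose tail s : \bar R := (\int[f s]_(x in `]0%R, +oo[) (x - cutoff e x)%:E)%E.
pose head s : \bar R := (\int[f s]_(x in `]0%R, +oo[) (cutoff e x)%:E)%E.
have split s : moment 1 (f s) = (head s + tail s)%E by exact: moment1_split.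
have head_ge0 s : (0 <= head s)%E.
  by apply: integral_ge0 => x /pos x0; rewrite lee_fin cutoff_ge0.
have tail_ge0 s : (0 <= tail s)%E.
  by apply: integral_ge0 => x /pos x0; rewrite lee_fin subr_ge0 cutoff_le.
have head_fin : head 0 \is a fin_num.
  by rewrite ge0_fin_numE// (le_lt_trans _ moo)// split leeDl.
have tail_fin : tail 0 \is a fin_num.
  by rewrite ge0_fin_numE// (le_lt_trans _ moo)// split leeDr.
have tail_nd (s : R) : 0 <= s -> (tail 0%R <= tail s)%E.
  move=> s0; have := le_moment1_of_not_gelling _ _ _ ng s0.
  rewrite !split => le_m; rewrite -(@leeD2lE _ (head 0))//.
  apply: le_trans le_m _; apply: leeD2r.
  apply: (dissipation_le _ _ _ _ wf _ _ _ _ s0).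
  - exact: measurable_cutoff.
  - exact: cutoff_bounded.
  - by move=> x y x0 y0; rewrite mulr_le0_ge0 ?K0// Delta_cutoff_le0.
pose A n : R := e * (3 / 2) ^+ n.
have A0 n : 0 < A n by rewrite mulr_gt0// exprn_gt0//; lra.
pose l n : R := ln (expR 1 + A n) `^ (alpha / 2).
have l0 n : 0 < l n.
  by rewrite powR_gt0// (lt_le_trans ltr01)// ln_expR1D_ge1// ltW.
have l2 n : ln (expR 1 + A n) `^ alpha = l n ^+ 2.
  by rewrite /l -powR_mulrn ?powR_ge0// -powRrM; congr (_ `^ _); lra.
have [Z ZP] := sum_ln_powR_inv_bounded _ _ _ a2 e0.
have Z0 : 0 <= Z by have := ZP 0%N; rewrite big_geq.
pose m : R := fine (moment 1 (f 0)).
have mE : moment 1 (f 0) = m%:E.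
  by rewrite fineK// ge0_fin_numE// ltW.
have m_ge0 : 0 <= m by rewrite fine_ge0// ltW.
pose delta : R := fine (tail 0).
have deltaE : tail 0 = delta%:E by rewrite fineK.
have delta0 : 0 < delta by rewrite -lte_fin -deltaE.
pose C : R := 3 / 4 * (12 * m + 1).
have C0 : 0 < C by rewrite /C; lra.
(* any k > C Z / delta contradicts delta k^2 <= k C Z *)
pose k : R := C * Z / delta + 1.
have k0 : 0 < k by rewrite ltr_wpDl// divr_ge0 ?(ltW delta0)// mulr_ge0 ?(ltW C0).
have kl0 n : 0 < k * l n by exact: mulr_gt0.
pose v n s : R := block_mass f (A n) s.
have mv n : measurable_fun (`[0, k ^+ 2]%classic : set R) (v n).
  exact: measurable_block_mass.
pose w n s : R := 3 / 4 * (k * l n * v n s ^+ 2 + (k * l n)^-1).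
have w0 n s : 0 <= w n s.
  apply: mulr_ge0; first by lra.
  by apply: addr_ge0; rewrite ?invr_ge0 ?(ltW (kl0 n))// mulr_ge0 ?sqr_ge0 ?ltW.
have mw n : measurable_fun (`[0, k ^+ 2]%classic : set R) (w n).
  apply: measurable_funM => //; apply: measurable_funD => //.
  by apply: measurable_funM => //; exact: measurable_funX.
have tail_w (s : R) : 0 <= s -> (delta%:E <= \sum_(n <oo) (w n s)%:E)%E.
  move=> s0; rewrite -deltaE; apply: le_trans (tail_nd s s0) _.
  apply: le_trans (tail_le_blocks _ _ _ _ _ wf K0 moo e0 s0) _.
  apply: lee_nneseries => n _.
    by rewrite lee_fin mulr_ge0 ?mulr_ge0 ?fine_ge0// ltW.
  rewrite lee_fin /w -/(A n) -/(v n s).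
  (* Young's inequality, as a square divided by k l *)
  have := sqr_ge0 (k * l n * v n s - 1).
  rewrite -(pmulr_rge0 _ (_ : 0 < (k * l n)^-1)) ?invr_gt0 ?kl0//.
  have -> : (k * l n)^-1 * (k * l n * v n s - 1) ^+ 2 =
    k * l n * v n s ^+ 2 + (k * l n)^-1 - 2 * v n s.
    by field; rewrite !gt_eqF.
  lra.
have int_w n : (\int[lebesgue_measure]_(s in `[0%R, (k ^+ 2)%R]) (w n s)%:E
    <= (k * C * (l n)^-1)%:E)%E.
  have mv2 : measurable_fun (`[0, k ^+ 2]%classic : set R) (fun s => (v n s ^+ 2)%:E).
    by apply/measurable_EFinP; exact: measurable_funX.
  have wE s : ((w n s)%:E = (3 / 4)%:E *
      ((k * l n)%:E * (v n s ^+ 2)%:E + ((k * l n)^-1)%:E))%E.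
    by [].
  under eq_integral do rewrite wE.
  rewrite ge0_integralZl_EFin//; last 2 first.
  - by move=> s _; rewrite adde_ge0 ?mule_ge0 ?lee_fin ?sqr_ge0 ?invr_ge0 ?(ltW (kl0 n)).
  - apply: emeasurable_funD => //; apply: measurable_funeM => //.
  rewrite ge0_integralD//; last 3 first.
  - by move=> s _; rewrite mule_ge0 ?lee_fin ?sqr_ge0 ?(ltW (kl0 n)).
  - exact: measurable_funeM.
  - by move=> s _; rewrite lee_fin invr_ge0 (ltW (kl0 n)).
  rewrite ge0_integralZl_EFin//; last 2 first.
  - by move=> s _; rewrite lee_fin sqr_ge0.
  - exact: ltW.
  rewrite [X in (_ + X)%E](_ : _ = ((k * l n)^-1 * k ^+ 2)%:E); last first.
    rewrite (integral_cst _ _ (k * l n)^-1%:E)// /= lebesgue_measure_itv/= lte_fin.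
    by rewrite exprn_gt0// oppr0 addr0 EFinM.
  have := block_estimate _ _ _ _ (k ^+ 2) a0 wf moo (A0 n) (sqr_ge0 _).
  rewrite l2 mE -/(v n).
  have : (0 <= \int[lebesgue_measure]_(s in `[0%R, (k ^+ 2)%R]) (v n s ^+ 2)%:E)%E.
    by apply: integral_ge0 => s _; rewrite lee_fin sqr_ge0.
  move: (\int[lebesgue_measure]_(s in _) _)%E => [y| |]// y0 Hy.
  - move: Hy; rewrite -EFinM !lee_fin => Hy.
    have -> : (k * l n)^-1 * k ^+ 2 = k * (l n)^-1 by field; rewrite !gt_eqF.
    have H : k * l n * y <= 12 * k * m * (l n)^-1.
      rewrite ler_pdivlMr//.
      have := ler_wpM2l (ltW k0) Hy; rewrite expr2; lra.
    rewrite /C; lra.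
  - by move: Hy; rewrite gt0_muley// lte_fin divr_gt0 ?exprn_gt0.
have : ((delta * k ^+ 2)%:E <= (k * C * Z)%:E :> \bar R)%E.
  have -> : ((delta * k ^+ 2)%:E =
      \int[lebesgue_measure]_(s in `[0%R, (k ^+ 2)%R]) (cst delta%:E s))%E.
    rewrite integral_cst//= lebesgue_measure_itv/= lte_fin.
    by rewrite exprn_gt0// oppr0 addr0 EFinM.
  apply: (@le_trans _ _ (\sum_(n <oo)
      \int[lebesgue_measure]_(s in `[0%R, (k ^+ 2)%R]) (w n s)%:E)%E).
    apply: le_integral_nneseries => //.
    - by move=> n; apply/measurable_EFinP; exact: mw.
    - by move=> s _; rewrite lee_fin ltW.
    - by move=> n s _; rewrite lee_fin.
    - by move=> s; rewrite /= in_itv/= => /andP[s0 _]; exact: tail_w.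
  apply: (@le_trans _ _ (\sum_(n <oo) (k * C * (l n)^-1)%:E)%E).
    by apply: lee_nneseries => // n _ _; apply: integral_ge0 => s _; rewrite lee_fin.
  apply: lime_le.
    apply: is_cvg_nneseries => n _ _.
    by rewrite lee_fin mulr_ge0 ?invr_ge0 ?(ltW (l0 n))// mulr_ge0// ltW.
  apply: nearW => N; rewrite sumEFin lee_fin -mulr_sumr.
  by apply: ler_wpM2l (ZP N); rewrite mulr_ge0// ltW.
rewrite lee_fin => H.
have : delta * k <= C * Z.
  by rewrite -(ler_pM2l k0); move: H; rewrite expr2; lra.
rewrite /k mulrDr mulr1 mulrCA mulfV ?gt_eqF// mulr1.
lra.
Qed.
(** * Cascades of shells *)

Definition flux (R : realType) (k : R) (l : nat -> R) (a : nat -> R -> R)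
    (n : nat) (t : R) : R :=
  \int[lebesgue_measure]_(s in `[0, t]) (k * (l n * a n s) ^+ 2).
Arguments flux {R} k l a n t.

(** The integrated form of the system a_0' = - k (l_0 a_0)^2 and
a_(n+1)' = k (l_n a_n)^2 - k (l_(n+1) a_(n+1))^2 started from a_0 = 1.  The
balance over the first N + 1 shells is what a truncated mass gives directly, and
it contains the initial condition as its value at t = 0. *)
Definition shell_cascade (R : realType) (k : R) (l : nat -> R) (a : nat -> R -> R) : Prop :=
  [/\ forall n s, 0 <= s -> 0 <= a n s,
      forall n t, measurable_fun (`[0, t]%classic : set R) (a n) &
      forall N t, 0 <= t ->
        ((\sum_(n < N.+1) a n t)%:E + \int[lebesgue_measure]_(s in `[0%R, t])
          (k * (l N * a N s) ^+ 2)%:E = 1)%E].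
Arguments shell_cascade {R} k l a.

Lemma bounded_itv_integrable (R : realType) (g : R -> R) (C : R) (i : interval R) (t : R) :
  [set` i] `<=` `[0, t]%classic ->
  measurable_fun (`[0, t]%classic : set R) g ->
  (forall s, 0 <= s -> `|g s| <= C) ->
  lebesgue_measure.-integrable [set` i] (EFin \o g).
Proof.
move=> iS mg gC; 
suff: lebesgue_measure.-integrable `[0, t]%classic (EFin \o g).
  by apply: integrableS; [exact: measurable_itv|exact: measurable_itv|].
apply: measurable_bounded_integrable => //.
  rewrite /= lebesgue_measure_itv/=; case: ifP => _; last by [].
  by rewrite -EFinD ltry.
exists C; split; first exact: num_real.
move=> M CM s /=; rewrite in_itv/= => /andP[s0 _].
by rewrite (le_trans (gC s s0))// ltW.
Qed.

Section shell_cascade_theory.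
Context (R : realType) (k : R) (l : nat -> R) (a : nat -> R -> R).
Hypotheses (k0 : 0 < k) (l0 : forall n, 0 < l n) (cas : shell_cascade k l a).

Let a0 n s : 0 <= s -> 0 <= a n s. Proof. by case: cas => + _ _; apply. Qed.

Let ma n t : measurable_fun (`[0, t]%classic : set R) (a n).
Proof. by case: cas => _ + _; apply. Qed.

Let g n s := k * (l n * a n s) ^+ 2.

Let g0 n s : 0 <= g n s. Proof. by rewrite mulr_ge0 ?sqr_ge0// ltW. Qed.

Let mg n t : measurable_fun (`[0, t]%classic : set R) (g n).
Proof.
by apply: measurable_funM => //; apply: measurable_funX; exact: measurable_funM.
Qed.

Lemma partial_massE N t : 0 <= t -> \sum_(n < N.+1) a n t = 1 - flux k l a N t.
Proof.
move=> t0; case: cas => _ _ /(_ N t t0); rewrite /flux /Rintegral.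
have : (0 <= \int[lebesgue_measure]_(s in `[0%R, t]) (k * (l N * a N s) ^+ 2)%:E)%E.
  by apply: integral_ge0 => s _; rewrite lee_fin; exact: g0.
move: (\int[lebesgue_measure]_(s in _) _)%E => [y| |]// y0.
by rewrite -EFinD => -[<-]; rewrite addrK.
Qed.

Lemma flux_ge0 n t : 0 <= flux k l a n t.
Proof. by apply: Rintegral_ge0 => s _; exact: g0. Qed.

Lemma shell_le1 n s : 0 <= s -> a n s <= 1.
Proof.
move=> s0; apply: (@le_trans _ _ (\sum_(i < n.+1) a i s)).
  by rewrite big_ord_recr/= lerDr sumr_ge0// => i _; exact: a0.
by rewrite partial_massE// gerBl flux_ge0.
Qed.

(** Shell n + 1 holds what has entered it minus what has left it. *)
Lemma shell_massE n t : 0 <= t -> a n.+1 t = flux k l a n t - flux k l a n.+1 t.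
Proof.
move=> t0; have := partial_massE n.+1 t t0.
by rewrite big_ord_recr/= partial_massE//; lra.
Qed.

Lemma flux_nonincreasing m n t : 0 <= t -> (m <= n)%N -> flux k l a n t <= flux k l a m t.
Proof.
move=> t0; elim: n => [|n IH]; first by rewrite leqn0 => /eqP->.
rewrite leq_eqVlt => /predU1P[->//|/IH]; apply: le_trans.
by rewrite -subr_ge0 -shell_massE// a0.
Qed.

Let g_int n (i : interval R) t : [set` i] `<=` `[0, t]%classic ->
  lebesgue_measure.-integrable [set` i] (EFin \o g n).
Proof.
move=> iS; apply: (bounded_itv_integrable _ _ (k * l n ^+ 2) _ t) => // s s0.
rewrite ger0_norm// ler_pM2l// lerXn2r ?nnegrE ?mulr_ge0 ?a0// ?(ltW (l0 n))//.
by rewrite ler_piMr ?shell_le1// ltW.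
Qed.

(** The integrated form of the differential inequality a_(n+1)' <= C. *)
Lemma shell_increment n C r t : 0 <= r -> r <= t ->
  (forall s, r < s <= t -> g n s - g n.+1 s <= C) ->
  a n.+1 t - a n.+1 r <= C * (t - r).
Proof.
move=> r0 rt gC.
have incr m : flux k l a m t - flux k l a m r =
    \int[lebesgue_measure]_(s in `]r, t]) g m s.
  by rewrite /flux Rintegral_itvB ?bnd_simp//; exact: (g_int m _ t (@subset_refl _ _)).
have sub : `]r, t]%classic `<=` (`[0, t]%classic : set R).
  by move=> s /=; rewrite !in_itv/= => /andP[rs ->]; rewrite andbT (le_trans r0)// ltW.
rewrite !shell_massE//; last exact: le_trans rt.
rewrite opprB addrACA [X in _ + X]addrC addrACA -addrA.
rewrite (_ : _ + _ = (flux k l a n t - flux k l a n r) -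
  (flux k l a n.+1 t - flux k l a n.+1 r)); last by lra.
rewrite !incr -RintegralB//; [|exact: (g_int _ _ t sub)|exact: (g_int _ _ t sub)].
apply: (@le_trans _ _ (\int[lebesgue_measure]_(s in `]r, t]) C)).
  apply: le_Rintegral => //.
  - rewrite (_ : _ \o _ = (EFin \o g n) \- (EFin \o g n.+1))%E//.
    by apply: integrableB => //; exact: (g_int _ _ t sub).
  - exact: (bounded_itv_integrable _ (cst C) `|C| _ t).
rewrite Rintegral_cst//= lebesgue_measure_itv/= lte_fin.
move: rt; rewrite le_eqVlt => /predU1P[->|->]//.
by rewrite ltxx subrr.
Qed.

(** At times when l_(n+1) a_(n+1) exceeds l_0, the outflow of shell n + 1 exceeds
the inflow, by the bound on shell n, so a_(n+1) decreases.  It therefore suffices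
to go back to the supremum of the earlier times at which the bound holds; such
times exist because l_(n+1) a_(n+1) starts from 0. *)
Lemma shell_max_principle : (forall n, l n <= l n.+1) ->
  forall n s, 0 <= s -> l n * a n s <= l 0.
Proof.
move=> ndl; elim=> [|n IH] t t0.
  by rewrite ler_piMr ?shell_le1// ltW.
have a00 : a n.+1 0 = 0.
  by rewrite shell_massE// /flux !set_itv1 !Rintegral_set1 subrr.
pose c := l 0 / l n.+1.
have c0 : 0 < c by rewrite divr_gt0.
suff : a n.+1 t <= c by rewrite mulrC -ler_pdivlMr.
pose E := [set s | 0 <= s <= t /\ a n.+1 s <= c].
have E0 : E 0 by rewrite /E/= lexx t0 a00 ltW.
have ubE : ubound E t by move=> s [/andP[]].
have supE : has_sup E by split; [exists 0|exists t].
have s0 : 0 <= sup E by apply: ub_le_sup => //; exists t.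
have st : sup E <= t by apply: ge_sup => //; exists 0.
apply/ler_addgt0Pl => e e0.
(* the inflow is at most k l_0^2, so a n.+1 gains at most e during a time eta *)
pose eta := e / (k * l 0 ^+ 2).
have kl0 : 0 < k * l 0 ^+ 2 by rewrite mulr_gt0// exprn_gt0.
have eta0 : 0 < eta by rewrite divr_gt0.
have [r Er rs] := sup_adherent eta0 supE.
have rsup : r <= sup E by apply: ub_le_sup => //; exists t.
move: Er => [/andP[r0 rt] arc].
have gle s : 0 <= s -> g n s <= k * l 0 ^+ 2.
  move=> s_ge0; rewrite ler_pM2l// lerXn2r ?nnegrE ?mulr_ge0 ?a0// ?(ltW (l0 _))//.
  exact: IH.
(* no time in ]sup E, t] satisfies the bound, so a n.+1 does not increase there *)
have H1 : a n.+1 t - a n.+1 (sup E) <= 0 * (t - sup E).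
  apply: shell_increment => // s /andP[Es stt].
  have s_ge0 : 0 <= s by rewrite (le_trans s0)// ltW.
  have cs : c < a n.+1 s.
    rewrite ltNge; apply/negP => asc; move: Es; rewrite ltNge => /negP; apply.
    by apply: ub_le_sup; [exists t|split => //; rewrite s_ge0].
  rewrite subr_le0 (le_trans (gle s s_ge0))// ler_pM2l//.
  rewrite lerXn2r ?nnegrE ?mulr_ge0 ?a0// ?(ltW (l0 _))//.
  by move: cs; rewrite /c ltr_pdivrMr// mulrC => /ltW.
have H2 : a n.+1 (sup E) - a n.+1 r <= k * l 0 ^+ 2 * (sup E - r).
  apply: shell_increment => // s /andP[rs' _].
  have s_ge0 : 0 <= s by rewrite (le_trans r0)// ltW.
  by rewrite lerBlDr (le_trans (gle s s_ge0))// lerDl.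
have H3 : k * l 0 ^+ 2 * (sup E - r) <= e.
  have : sup E - r <= eta by lra.
  by rewrite /eta ler_pdivlMr// mulrC.
lra.
Qed.

(** One of the two factors l_n a_n of the outflow is bounded by l_0. *)
Lemma flux_le_shell_mass n t : (forall n, l n <= l n.+1) -> 0 <= t ->
  flux k l a n t * (l n)^-1 <= k * l 0 * \int[lebesgue_measure]_(s in `[0, t]) a n s.
Proof.
move=> ndl t0.
have aint : lebesgue_measure.-integrable `[0, t]%classic (EFin \o a n).
  by apply: (bounded_itv_integrable _ _ 1 _ t) => // s s0; rewrite ger0_norm ?a0// shell_le1.
rewrite ler_pdivrMr// mulrAC -RintegralZl// /flux.
apply: le_Rintegral => //.
- exact: (g_int n _ t (@subset_refl _ _)).
- apply: (bounded_itv_integrable _ _ (k * l 0 * l n) _ t) => // [|s s0].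
    by apply: measurable_funM => //; exact: ma.
  have c0 : 0 <= k * l 0 * l n by rewrite !mulr_ge0// ltW.
  by rewrite ger0_norm ?ler_piMr ?shell_le1// mulr_ge0// a0.
- move=> s; rewrite /= in_itv/= => /andP[s0 _].
  rewrite expr2 -!mulrA ler_pM2l// mulrA.
  by rewrite ler_wpM2r ?shell_max_principle// mulr_ge0 ?a0// ltW.
Qed.

(** The flux decreases along the cascade, so the flux out of shell N is at most the
flux out of each earlier shell; the shells together hold at most mass 1. *)
Lemma flux_decay N t : (forall n, l n <= l n.+1) -> 0 <= t ->
  flux k l a N t * \sum_(n < N.+1) (l n)^-1 <= k * l 0 * t.
Proof.
move=> ndl t0.
have aint n : lebesgue_measure.-integrable `[0, t]%classic (EFin \o a n).
  by apply: (bounded_itv_integrable _ _ 1 _ t) => // s s0; rewrite ger0_norm ?a0// shell_le1.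
apply: (@le_trans _ _ (k * l 0 * \sum_(n < N.+1) \int[lebesgue_measure]_(s in `[0, t]) a n s)).
  rewrite !mulr_sumr; apply: ler_sum => n _.
  apply: le_trans (flux_le_shell_mass n t ndl t0).
  by rewrite ler_wpM2r ?invr_ge0 ?(ltW (l0 _))// flux_nonincreasing// -ltnS.
rewrite ler_pM2l ?mulr_gt0//.
have -> : \sum_(n < N.+1) \int[lebesgue_measure]_(s in `[0, t]) a n s =
    \int[lebesgue_measure]_(s in `[0, t]) (\sum_(n < N.+1) a n s).
  have aintE n : (\int[lebesgue_measure]_(s in `[0%R, t]) (a n s)%:E =
      (\int[lebesgue_measure]_(s in `[0, t]) a n s)%R%:E)%E.
    by rewrite /Rintegral fineK//; apply: integrable_fin_num (aint n).
  rewrite [RHS]/Rintegral; under [in RHS]eq_integral do rewrite -sumEFin.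
  rewrite integral_sum//; last by move=> n; exact: (aint n).
  transitivity (fine (\sum_(n < N.+1) (\int[lebesgue_measure]_(s in `[0, t]) a n s)%:E)).
    by rewrite sumEFin.
  by congr fine; apply: eq_bigr => n _; rewrite -aintE.
apply: (@le_trans _ _ (\int[lebesgue_measure]_(s in `[0, t]) 1)).
  apply: le_Rintegral => //.
  - apply: (bounded_itv_integrable _ _ 1 _ t) => // [|s s0].
      by apply: measurable_sum => n; exact: ma.
    rewrite ger0_norm ?sumr_ge0//; last by move=> n _; exact: a0.
    by rewrite partial_massE// gerBl flux_ge0.
  - by apply: (bounded_itv_integrable _ (cst 1) 1 _ t) => // s _; rewrite normr1.
  - move=> s; rewrite /= in_itv/= => /andP[s0 _].
    by rewrite partial_massE// gerBl flux_ge0.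
rewrite Rintegral_cst//= lebesgue_measure_itv/= lte_fin mul1r.
by case: ifP => //=; rewrite subr0.
Qed.

End shell_cascade_theory.
(** * Powers of two *)

Lemma Kalpha_eq0 (R : realType) (alpha x y : R) : 0 < x -> 2 * x <= y ->
  Kalpha alpha x y = 0 /\ Kalpha alpha y x = 0.
Proof.
move=> x0 xy; have xley : x <= y by lra.
have y0 : 0 < y by exact: lt_le_trans xley.
rewrite /Kalpha (minC y) (maxC y) (min_idPl xley) (max_idPr xley).
rewrite (max_idPr _) ?mulr0 ?mul0r//.
by rewrite subr_le0 ler_pdivrMr//; lra.
Qed.

Lemma Kalpha_diag (R : realType) (alpha x : R) : 0 < x ->
  Kalpha alpha x x = x / 2 * ln (expR 1 + x) `^ alpha.
Proof.
move=> x0; rewrite /Kalpha minxx maxxx divff ?gt_eqF// (max_idPl _); last by lra.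
by congr (_ * _ * _); lra.
Qed.

Definition pow2 (R : realType) : set R := range (fun n => 2 ^+ n).
Arguments pow2 {R}.

Lemma Kalpha_pow2_neq (R : realType) (alpha x y : R) : pow2 x -> pow2 y -> x != y ->
  Kalpha alpha x y = 0.
Proof.
have lt_pow2 (m n : nat) : (m < n)%N -> 2 * 2 ^+ m <= 2 ^+ n :> R.
  by move=> mn; rewrite -exprS ler_weXn2l// ler1n.
move=> [m _ <-] [n _ <-]; case: (ltngtP m n) => [mn|nm|->]; last by rewrite eqxx.
- by move=> _; have [] := Kalpha_eq0 R alpha _ _ (exprn_gt0 m _) (lt_pow2 _ _ mn).
- by move=> _; have [] := Kalpha_eq0 R alpha _ _ (exprn_gt0 n _) (lt_pow2 _ _ nm).
Qed.

Lemma measurable_pow2C (R : realType) : measurable (~` pow2 : set R).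
Proof.
apply: measurableC; apply: countable_measurable => //.
exact: card_image_le.
Qed.

Lemma pow2_eq (R : realType) (m n : nat) : (2 ^+ m == 2 ^+ n :> R) = (m == n).
Proof. by rewrite eq_le !ler_eXn2l ?ltr1n// -eqn_leq. Qed.

(** * The solution issued from a Dirac mass at 1 *)

Section dirac_start.
Context (R : realType) (alpha : R) (f : R -> borel_measure R).
Hypotheses (wf : weak_solution (Kalpha alpha) f)
  (f0 : forall A : set (measurableTypeR R), measurable A -> f 0 A = \d_(1 : R) A).

Let pos (x : R) : `]0, +oo[%classic x -> 0 < x.
Proof. by rewrite /= in_itv/= andbT. Qed.

Lemma integral_initial (h : R -> R) :
  measurable_fun (`]0, +oo[%classic : set R) h ->
  (\int[f 0%R]_(x in `]0%R, +oo[) (h x)%:E = (h 1)%:E)%E.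
Proof.
move=> mh; rewrite (@eq_measure_integral _ _ _ _ \d_(1 : measurableTypeR R)); last first.
  by move=> A mA _; exact: f0.
rewrite integral_dirac//; last exact/measurable_EFinP.
by rewrite diracE mem_set ?mul1e//= in_itv/= ltr01.
Qed.

Lemma moment1_initial : moment 1 (f 0%R) = 1%E.
Proof. by rewrite moment1E (integral_initial (fun x => x)). Qed.

(** The number of particles whose size is not a power of two cannot increase: a
merger of two powers of two involves equal sizes and produces a power of two, and
any other merger consumes at least one of these particles while producing at most
one. *)
Lemma support_pow2 t : 0 <= t -> f t (~` pow2 `&` `]0, +oo[) = 0%E.
Proof.
move=> t0.
have mi (D : set R) : measurable_fun D (\1_(~` pow2) : R -> R).
  by apply: measurable_indic; exact: measurable_pow2C.
apply/eqP; rewrite eq_le measure_ge0 andbT.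
rewrite -integral_indic; [|exact: measurable_itv|exact: measurable_pow2C].
apply: le_trans (dissipation_le _ _ _ (\1_(~` pow2)) wf _ _ _ _ t0) _.
- exact: mi.
- by exists 1 => x _; rewrite indicE ler0n lern1 leq_b1.
- move=> x y x0 y0; have Kxy := Kalpha_ge0 R alpha x y x0 y0.
  have i01 (z : R) : 0 <= (\1_(~` pow2) z : R) <= 1 by rewrite indicE ler0n lern1 leq_b1.
  have iC (z : R) : ~ pow2 z -> \1_(~` pow2) z = 1 :> R by move=> nz; rewrite indicE mem_set.
  have i0 (z : R) : pow2 z -> \1_(~` pow2) z = 0 :> R by move=> nz; rewrite indicE memNset//; exact.
  have [xS|xS] := pselect (pow2 x); last first.
    by apply: mulr_le0_ge0 => //; rewrite /Delta (iC x).
  have [yS|yS] := pselect (pow2 y); last first.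
    by apply: mulr_le0_ge0 => //; rewrite /Delta (iC y).
  have [<-|xy] := eqVneq x y; last by rewrite Kalpha_pow2_neq// mulr0.
  rewrite /Delta !i0 ?subrr ?mul0r//; last first.
  by case: xS => n _ <-; exists n.+1; rewrite // exprS; lra.
rewrite integral_initial; last exact: mi.
by rewrite lee_fin indicE memNset//=; apply; exists 0%N; rewrite // expr0.
Qed.

Definition atom_mass n s : R := 2 ^+ n * fine (f s [set 2 ^+ n]).

Lemma atom_fin_num n t : 0 <= t -> f t [set 2 ^+ n] \is a fin_num.
Proof.
move=> t0.
have m0 : (moment 1 (f 0%R) < +oo)%E by rewrite moment1_initial ltry.
have n0 : 0 < 2 ^+ n :> R by exact: exprn_gt0.
have := tail_fin_num _ _ _ _ _ wf (Kalpha_ge0 R alpha) m0 n0 t0.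
rewrite !ge0_fin_numE//; apply: le_lt_trans; apply: le_measure; rewrite ?inE.
- exact: measurable_set1.
- exact: measurable_itv.
- by move=> x /= ->; rewrite in_itv/= lexx.
Qed.

Lemma atom_massE n t : 0 <= t -> (atom_mass n t)%:E = ((2 ^+ n)%:E * f t [set (2 ^+ n)%R])%E.
Proof. by move=> t0; rewrite /atom_mass EFinM fineK// atom_fin_num. Qed.

Lemma integral_atom t n (c : R) : 0 <= t -> 0 <= c ->
  (\int[f t]_(x in `]0%R, +oo[) (c * \1_[set 2 ^+ n] x)%:E = c%:E * f t [set (2 ^+ n)%R])%E.
Proof.
move=> t0 c0; under eq_integral do rewrite EFinM.
have m1 : measurable ([set 2 ^+ n] : set (measurableTypeR R)) by exact: measurable_set1.
rewrite ge0_integralZl_EFin//; last first.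
  by apply/measurable_EFinP; exact: measurable_indic.
rewrite integral_indic// setIidl// => x /= ->.
by rewrite in_itv/= andbT exprn_gt0.
Qed.

Lemma sum_atoms_eq (m N : nat) :
  \sum_(n < N.+1) (2 ^+ n * \1_[set 2 ^+ n] (2 ^+ m : R)) = cutoff (2 ^+ N) (2 ^+ m) :> R.
Proof.
have atomE n : 2 ^+ n * \1_[set 2 ^+ n] (2 ^+ m : R) = if n == m then 2 ^+ m else 0 :> R.
  rewrite indicE in_set1 pow2_eq eq_sym.
  by case: eqP => [->|_]; rewrite ?mulr1 ?mulr0.
under eq_bigr do rewrite atomE.
rewrite cutoffE ler_eXn2l ?ltr1n//; case: ifPn => [mN|].
  rewrite (bigD1 (Ordinal (mN : (m < N.+1)%N)))//= eqxx big1 ?addr0// => i.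
  by rewrite -val_eqE/= => /negbTE ->.
rewrite -ltnNge => Nm; rewrite big1// => i _.
by rewrite ltn_eqF// (leq_ltn_trans _ Nm)// -ltnS.
Qed.

Lemma integral_off_pow2 t (g h : R -> \bar R) : 0 <= t ->
  (forall x, 0 < x -> (0 <= g x)%E) -> (forall x, 0 < x -> (0 <= h x)%E) ->
  (forall m, g (2 ^+ m) = h (2 ^+ m)) ->
  (\int[f t]_(x in `]0%R, +oo[) g x = \int[f t]_(x in `]0%R, +oo[) h x)%E.
Proof.
move=> t0 g0 h0 gh.
apply: (ge0_eq_integral_off_null _ (measurableTypeR R) _ (f t) _ (~` pow2 `&` `]0, +oo[)).
- by apply: measurableI; [exact: measurable_pow2C|exact: measurable_itv].
- exact: support_pow2.
- by move=> x /pos; exact: g0.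
- by move=> x /pos; exact: h0.
- move=> x x0 xN; have : pow2 x by apply: contrapT => xS; apply: xN.
  by move=> [m _ <-].
Qed.

Lemma integral_cutoff N t : 0 <= t ->
  (\int[f t]_(x in `]0%R, +oo[) (cutoff (2 ^+ N) x)%:E =
    (\sum_(n < N.+1) atom_mass n t)%:E)%E.
Proof.
move=> t0.
have i0 n x : 0 <= 2 ^+ n * \1_[set 2 ^+ n] x :> R.
  by rewrite mulr_ge0 ?exprn_ge0// indicE ler0n.
have m1 n : measurable ([set 2 ^+ n] : set (measurableTypeR R)) by exact: measurable_set1.
rewrite (integral_off_pow2 t _
  (fun x => (\sum_(n < N.+1) (2 ^+ n * \1_[set 2 ^+ n] x)%:E)%R) t0).
- rewrite ge0_integral_sum//.
  + rewrite -sumEFin; apply: eq_bigr => n _.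
    by rewrite integral_atom// ?exprn_ge0// atom_massE.
  + by move=> n; apply/measurable_EFinP; exact: measurable_funM.
- by move=> x x0; rewrite lee_fin cutoff_ge0.
- by move=> x x0; rewrite sumEFin lee_fin sumr_ge0.
- by move=> m; rewrite sumEFin sum_atoms_eq.
Qed.

(** Among powers of two, the only merger that makes the truncated mass decrease is
2^N with 2^N: it loses 2 * 2^N, and K(2^N, 2^N) = 2^N l^2 / 2. *)
Lemma dissipation_cutoff N s : 0 <= s ->
  (\int[f s]_(x in `]0%R, +oo[) \int[f s]_(y in `]0%R, +oo[)
    (- (Delta (cutoff (2 ^+ N)) x y * Kalpha alpha x y))%:E =
  ((ln (expR 1 + 2 ^+ N) `^ (alpha / 2) * atom_mass N s) ^+ 2)%:E)%E.
Proof.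
move=> s0; set l := ln _ `^ _.
have l0 : 0 <= l by exact: powR_ge0.
have ge0 x y : 0 < x -> 0 < y ->
    (0 <= (- (Delta (cutoff (2 ^+ N)) x y * Kalpha alpha x y))%:E)%E.
  move=> x0 y0; rewrite lee_fin oppr_ge0 mulr_le0_ge0 ?Kalpha_ge0//.
  exact: Delta_cutoff_le0.
pose c : R := 2 ^+ N * 2 ^+ N * l ^+ 2.
have c0 : 0 <= c by rewrite mulr_ge0 ?sqr_ge0// mulr_ge0 ?exprn_ge0.
have i0 (x : R) : 0 <= (\1_[set 2 ^+ N] x : R) by rewrite indicE ler0n.
have val m n : - (Delta (cutoff (2 ^+ N)) (2 ^+ m) (2 ^+ n) * Kalpha alpha (2 ^+ m) (2 ^+ n)) =
    c * \1_[set 2 ^+ N] (2 ^+ m : R) * \1_[set 2 ^+ N] (2 ^+ n : R) :> R.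
  have atomE p : \1_[set 2 ^+ N] (2 ^+ p : R) = (p == N)%:R :> R.
    by rewrite indicE in_set1 pow2_eq.
  rewrite !atomE; have [<-|mn] := eqVneq m n; last first.
    rewrite Kalpha_pow2_neq ?mulr0 ?oppr0; [|by exists m|by exists n|by rewrite pow2_eq].
    have [mN|_] := eqVneq m N; last by rewrite /= mulr0 mul0r.
    by rewrite -mN (eq_sym n) (negbTE mn) mulr0.
  rewrite Kalpha_diag ?exprn_gt0// /Delta -{1}[2 ^+ m]mulr1 -{2}[2 ^+ m]mulr1 -mulrDr.
  rewrite (_ : 1 + 1 = 2)// -exprSr !cutoffE !ler_eXn2l ?ltr1n//.
  case: (ltngtP m N) => [_|_|->].
  - by rewrite /= exprSr; ring.
  - by rewrite /=; ring.
  have -> : ln (expR 1 + 2 ^+ N) `^ alpha = l ^+ 2 :> R.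
    by rewrite /l -(powR_mulrn 2 (powR_ge0 _ _)) -powRrM; congr (_ `^ _); lra.
  by rewrite /= /c !mulr1; field.
have inner m : (\int[f s]_(y in `]0%R, +oo[)
    (- (Delta (cutoff (2 ^+ N)) (2 ^+ m) y * Kalpha alpha (2 ^+ m) y))%:E =
    (c * \1_[set 2 ^+ N] (2 ^+ m : R))%:E * f s [set (2 ^+ N)%R])%E.
  rewrite (integral_off_pow2 s _
    (fun y => (c * \1_[set 2 ^+ N] (2 ^+ m : R) * \1_[set 2 ^+ N] y)%:E) s0).
  - by rewrite integral_atom// mulr_ge0.
  - by move=> x x0; apply: ge0 => //; exact: exprn_gt0.
  - by move=> x x0; rewrite lee_fin mulr_ge0// mulr_ge0.
  - by move=> n; rewrite val.
rewrite (integral_off_pow2 s _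
  (fun x => ((c * fine (f s [set 2 ^+ N])) * \1_[set 2 ^+ N] x)%:E) s0).
- rewrite integral_atom// ?mulr_ge0 ?fine_ge0//.
  rewrite -{2}(fineK (atom_fin_num N s s0)) -EFinM /atom_mass; congr EFin.
  by rewrite /c; ring.
- by move=> x x0; apply: integral_ge0 => y /pos y0; exact: ge0.
- by move=> x x0; rewrite lee_fin mulr_ge0// mulr_ge0 ?fine_ge0.
- by move=> m; rewrite inner -{1}(fineK (atom_fin_num N s s0)) -EFinM; congr EFin; ring.
Qed.

Lemma measurable_atom_mass n t :
  measurable_fun (`[0, t]%classic : set R) (atom_mass n).
Proof.
case: wf => -[_ mf] _ _.
apply: measurable_funM => //.
apply: (@measurableT_comp _ _ _ _ _ _ fine _ (fun s => f s [set 2 ^+ n])).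
  exact: fine_measurable.
apply: measurable_funS (mf _ (measurable_set1 _)) => //.
by move=> x /=; rewrite !in_itv/= andbT => /andP[].
Qed.

Lemma atom_mass_cascade :
  shell_cascade 2^-1 (fun n => ln (expR 1 + 2 ^+ n) `^ (alpha / 2)) atom_mass.
Proof.
split.
- by move=> n s s0; rewrite mulr_ge0 ?exprn_ge0 ?fine_ge0.
- exact: measurable_atom_mass.
move=> N t t0.
have := dissipation _ _ _ (cutoff (2 ^+ N)) wf (measurable_cutoff _ _ _)
  (cutoff_bounded _ _) _ t t0.
rewrite integral_cutoff// integral_initial; last exact: measurable_cutoff.
rewrite cutoffE exprn_ege1 ?ler1n// => <-; last first.
  by move=> x y x0 y0; rewrite mulr_le0_ge0 ?Kalpha_ge0// Delta_cutoff_le0.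
congr (_ + _)%E.
under eq_integral do rewrite EFinM.
rewrite ge0_integralZl_EFin//; last 2 first.
- by move=> s _; rewrite lee_fin sqr_ge0.
- apply/measurable_EFinP; apply: measurable_funX; apply: measurable_funM => //.
  exact: measurable_atom_mass.
congr (_ * _)%E; apply: eq_integral => s.
by rewrite inE/= in_itv/= => /andP[s0 _]; rewrite dissipation_cutoff.
Qed.

End dirac_start.
(** * No gelation for exponents at most 2 *)

(** By [flux_decay] the flux is at most k l_0 t divided by the sum of the 1/l_n,
which dominates a multiple of the harmonic series. *)
Lemma flux_vanishes (R : realType) (k : R) (l : nat -> R) (a : nat -> R -> R) (t e : R) :
  0 < k -> (forall n, 0 < l n) -> (forall n, l n <= l n.+1) ->
  (exists C : R, forall n, l n <= C * n.+1%:R) ->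
  shell_cascade k l a -> 0 <= t -> 0 < e ->
  exists N, flux k l a N t <= e.
Proof.
move=> k0 l0 ndl [C lC] cas t0 e0.
have C0 : 0 < C by have := lt_le_trans (l0 0) (lC 0%N); rewrite mulr1.
have harm : series harmonic n @[n --> \oo] --> (+oo : set_system R).
  apply: nondecreasing_dvgn_lt; last exact: dvg_harmonic.
  by apply: nondecreasing_series => n _ _; exact: harmonic_ge0.
have /cvgryPge/(_ (C * (k * l 0 * t) / e)) [N _ HN] := harm.
exists N.
have := flux_decay R k l a k0 l0 cas N t ndl t0.
set S := \sum_(n < N.+1) _ => HS.
have SH : C^-1 * series harmonic N.+1 <= S.
  rewrite /series/= mulr_sumr big_mkord; apply: ler_sum => n _.
  by rewrite -invfM lef_pV2 ?posrE ?mulr_gt0.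
have H : (k * l 0 * t) / e <= S.
  apply: le_trans SH; have := HN N.+1 (leqnSn N).
  by rewrite -mulrA -ler_pdivlMl.
have [//|ef] := leP (flux k l a N t) e.
have S0 : 0 < S.
  rewrite /S big_ord_recl ltr_pwDl ?invr_gt0// sumr_ge0// => i _.
  by rewrite invr_ge0 ltW.
have : k * l 0 * t <= e * S by rewrite -ler_pdivrMl// mulrC.
have : e * S < flux k l a N t * S by rewrite ltr_pM2r.
lra.
Qed.

(** The exponent alpha/2 <= 1 enters through l_n <= ln(e + 2^n) <= 2 (n + 1). *)
Lemma moment1_dirac_start (R : realType) (alpha : R) (f : R -> borel_measure R) (t : R) :
  0 < alpha <= 2 -> weak_solution (Kalpha alpha) f ->
  (forall A : set (measurableTypeR R), measurable A -> f 0 A = \d_(1 : R) A) ->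
  0 <= t -> moment 1 (f t) = 1%E.
Proof.
move=> /andP[a0 a2] wf f0 t0.
have cas := atom_mass_cascade R alpha f wf f0.
set l := (fun n => _) in cas.
have k0 : 0 < 2^-1 :> R by rewrite invr_gt0.
have ln1 n : 1 <= ln (expR 1 + 2 ^+ n) :> R by apply: ln_expR1D_ge1; rewrite exprn_ge0.
have l0 n : 0 < l n by rewrite powR_gt0// (lt_le_trans ltr01).
have ndl n : l n <= l n.+1.
  rewrite ge0_ler_powR ?nnegrE//; [by lra|by rewrite (le_trans ler01)|by rewrite (le_trans ler01)|].
  have e1 := expR_gt0 (1 : R).
  rewrite ler_ln ?posrE ?addr_gt0 ?exprn_gt0// lerD2l.
  by rewrite ler_weXn2l// ler1n.
have lC n : l n <= 2 * n.+1%:R.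
  apply: (@le_trans _ _ (ln (expR 1 + 2 ^+ n))).
    by apply: ler1_powR => //; lra.
  have e2 : 2 <= expR 1 :> R by have := expR_ge1Dx (1 : R).
  have H : expR 1 + 2 ^+ n <= expR (n%:R + 2) :> R.
    have -> : expR (n%:R + 2) = expR 1 * expR 1 * expR 1 ^+ n :> R.
      by rewrite -expRM_natl mulr1 -!expRD; congr expR; lra.
    have h1 : 2 ^+ n <= expR 1 ^+ n :> R by rewrite lerXn2r ?nnegrE ?expR_ge0.
    have h2 : 1 <= expR 1 ^+ n :> R by rewrite exprn_ege1// (le_trans _ e2)// ler1n.
    move: (expR 1) (expR 1 ^+ n) e2 h1 h2 => E P E2 h1 h2.
    have EP : 0 <= E * P by rewrite mulr_ge0; lra.
    have h3 : 0 <= E * (P - 1) by rewrite mulr_ge0; lra.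
    have h4 : 0 <= (E - 1) * P by rewrite mulr_ge0; lra.
    have h5 : 0 <= (E - 2) * (E * P) by rewrite mulr_ge0; lra.
    lra.
  rewrite -ler_ln ?posrE ?expR_gt0 ?addr_gt0 ?expR_gt0 ?exprn_gt0// expRK in H.
  by rewrite -natr1; have := ler0n R n; lra.
apply/eqP; rewrite eq_le; apply/andP; split.
  have m1 n : measurable ([set 2 ^+ n] : set (measurableTypeR R)) by exact: measurable_set1.
  have i0 n x : (0 <= (2 ^+ n * \1_[set 2 ^+ n] (x : R))%:E :> \bar R)%E.
    by rewrite lee_fin mulr_ge0 ?exprn_ge0// indicE ler0n.
  rewrite moment1E; apply: (@le_trans _ _ (\int[f t]_(x in `]0%R, +oo[)
      \sum_(n <oo) (2 ^+ n * \1_[set 2 ^+ n] (x : R))%:E)%E).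
    apply: (ge0_le_integral_off_null _ (measurableTypeR R) _ (f t) _
      (~` pow2 `&` `]0, +oo[)).
    - by apply: measurableI; [exact: measurable_pow2C|exact: measurable_itv].
    - exact: support_pow2 wf f0 _ t0.
    - by move=> x; rewrite /= in_itv/= andbT lee_fin => /ltW.
    - by move=> x _; apply: nneseries_ge0 => n _ _; exact: i0.
    - move=> x x0 xN; have : pow2 x by apply: contrapT => xS; apply: xN.
      move=> [m _ <-]; apply: le_trans (nneseries_term_le _ _ m (fun n => i0 n _)).
      by rewrite indicE in_set1 eqxx mulr1.
  rewrite integral_nneseries//; last first.
    by move=> n; apply/measurable_EFinP; exact: measurable_funM.
  under eq_eseriesr do rewrite (integral_atom R f) ?exprn_ge0// -(atom_massE R alpha f wf f0)//.
  apply: lime_le.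
    apply: is_cvg_nneseries => n _ _.
    by rewrite lee_fin mulr_ge0 ?exprn_ge0 ?fine_ge0.
  apply: nearW => -[|N]; first by rewrite big_geq.
  rewrite big_mkord sumEFin (partial_massE R _ _ _ k0 cas)// lee_fin.
  by rewrite gerBl flux_ge0.
apply/lee_addgt0Pr => e e0.
have [N HN] := flux_vanishes R _ l _ t e k0 l0 ndl (ex_intro _ 2 lC) cas t0 e0.
apply: (@le_trans _ _ ((\sum_(n < N.+1) atom_mass R f n t)%:E + e%:E)%E).
  by rewrite (partial_massE R _ _ _ k0 cas)// -EFinD lee_fin; lra.
apply: leeD2r; rewrite -(integral_cutoff R alpha f wf f0)// moment1E.
apply: ge0_le_integral_nonmeasurable => x; rewrite /= in_itv/= andbT => x0.
  by rewrite lee_fin cutoff_ge0.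
by rewrite lee_fin cutoff_le.
Qed.
Theorem proposition6 (R : realType) (alpha : R) (halpha : 0 < alpha) :
  (2 < alpha ->
     forall f : R -> borel_measure R,
       weak_solution (Kalpha alpha) f ->
       (0 < moment 1 (f 0%R) < +oo)%E ->
       gelling f)
  /\
  (alpha <= 2 ->
     forall f : R -> borel_measure R,
       weak_solution (Kalpha alpha) f ->
       (forall A : set (measurableTypeR R), measurable A -> f 0 A = \d_(1 : R) A) ->
       non_gelling f).

Proof.
split=> [alpha2 f wf M1|alpha2 f wf f0 t t0].
  exact: gelling_of_log_power alpha2 wf M1.
have alpha02 : 0 < alpha <= 2 by rewrite halpha.
by rewrite (moment1_dirac_start R alpha f t) ?(moment1_dirac_start R alpha f 0).
Qed.
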